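(* Let $d\ge 1$ be an integer and let $n \le 2d + \rho(d)-1$, where $\rho$ is the Hurwitz--Radon function. Then any embedding $f\colon \mathbb{R}^d \to \mathbb{R}^n$ inscribes a trapezoid or maps three distinct points to a line.
   Context: Hurwitz--Radon function: write $d$ as the product of an odd number and $2^{4a+b}$ with integers $a\ge 0$ and $0\le b\le 3$; then $\rho(d) := 2^b+8a$. Equivalently, $\rho(d)$ is the largest integer such that there exists a bilinear map $B\colon \mathbb{R}^{\rho(d)}\times\mathbb{R}^d\to\mathbb{R}^d$ that is nonsingular, i.e. $B(x,y)=0$ if and only if $x=0$ or $y=0$. Embedding means topological embedding (in particular continuous and injective). The map $f$ inscribes a trapezoid if its image contains the four vertices of a trapezoid, i.e. there are four pairwise distinct points $u_1,v_1,u_2,v_2\in f(\mathbb{R}^d)$, no three of them collinear, and reals $t_1,t_2>0$ with $t_1(u_1-v_1)=t_2(u_2-v_2)$ (parallelograms count as trapezoids). The map $f$ maps three distinct points to a line if there are three distinct points of $\mathbb{R}^d$ whose images under $f$ lie on a common affine line. *)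

(* Defs.v *)
From HB Require Import structures.
From mathcomp Require Import all_boot all_order all_algebra.
From mathcomp Require Import all_classical all_reals all_analysis.

Set Implicit Arguments.
Unset Strict Implicit.
Unset Printing Implicit Defensive.

Import Order.TTheory GRing.Theory Num.Theory.
Import numFieldNormedType.Exports.

Local Open Scope classical_set_scope.
Local Open Scope ring_scope.

Definition hurwitz_radon (d : nat) : nat :=
  (2 ^ (logn 2 d %% 4) + 8 * (logn 2 d %/ 4))%N.

Lemma hurwitz_radonE (m a b : nat) : odd m -> (b <= 3)%N ->
  hurwitz_radon (m * 2 ^ (4 * a + b)) = (2 ^ b + 8 * a)%N.
Proof.
move=> mo b3; rewrite /hurwitz_radon.
have -> : logn 2 (m * 2 ^ (4 * a + b)) = (4 * a + b)%N.
  rewrite logn_Gauss ?pfactorK //.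
  by rewrite coprime2n.
by rewrite mulnC modnMDl modn_small // divnMDl // divn_small // addn0.
Qed.

(* The inverse [range f -> X] is continuous for the topology induced by [Y] on
   [range f]: images of open sets are relatively open. *)
Definition topological_embedding (X Y : topologicalType) (f : X -> Y) : Prop :=
  [/\ injective f,
      continuous f &
      forall A : set X, open A -> open (f @` A : set (subspace (range f)))].

Section Lines.
Context {R : realType} {n : nat}.

Definition affine_line (L : set 'rV[R]_n) : Prop :=
  exists p v : 'rV[R]_n, v != 0 /\ L = [set p + t *: v | t in [set: R]].

Definition collinear (x y z : 'rV[R]_n) : Prop :=
  exists L : set 'rV[R]_n, affine_line L /\ [/\ L x, L y & L z].

(* The parallel sides are [u1 v1] and [u2 v2], oriented alike; parallelograms
   are included. *)
Definition trapezoid (u1 v1 u2 v2 : 'rV[R]_n) : Prop :=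
  [/\ uniq [:: u1; v1; u2; v2],
      [/\ ~ collinear u1 v1 u2, ~ collinear u1 v1 v2,
          ~ collinear u1 u2 v2 & ~ collinear v1 u2 v2] &
      exists t1 t2 : R,
        [/\ 0 < t1, 0 < t2 & t1 *: (u1 - v1) = t2 *: (u2 - v2)]].

End Lines.

Definition inscribes_trapezoid {R : realType} {d n : nat}
    (f : 'rV[R]_d -> 'rV[R]_n) : Prop :=
  exists u1 v1 u2 v2 : 'rV[R]_n,
    [/\ range f u1, range f v1, range f u2 & range f v2] /\
    trapezoid u1 v1 u2 v2.

Definition maps_three_points_to_line {R : realType} {d n : nat}
    (f : 'rV[R]_d -> 'rV[R]_n) : Prop :=
  exists x y z : 'rV[R]_d, uniq [:: x; y; z] /\ collinear (f x) (f y) (f z).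

(* Main.v *)
Require Import Defs.
From HB Require Import structures.
From mathcomp Require Import all_boot all_order all_algebra.
From mathcomp Require Import all_classical all_reals all_analysis.
From mathcomp Require Import zify lra.
Import Order.TTheory GRing.Theory Num.Theory.
Import numFieldNormedType.Exports.

Local Open Scope classical_set_scope.
Local Open Scope ring_scope.

(* Write [d = m j] with [j] the 2-part of [d]; then [rho(d) <= j], so it is
   enough to exclude [n <= 2 d - 1 + j].

   If [f] has no trapezoid and no collinear triple, the directed chords of [f]
   determine their end points: in
     [F(u, c, t) = exp t (f(c + u) - f(c - u))]
   the value determines [(u, c, t)] as soon as it is nonzero, and it vanishes
   only for [u = 0].  Hence
     [Phi(p, q, w) = F(p + q, w) - F(p - q, - w)],
   with [w = (c, t)], has no zero on [S^(2d-1) x S^j], whose points are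
   [((p, q), w)].  It is odd both for [(p, q) -> (- p, - q)] and for
   [(q, w) -> (- q, - w)].  Let [x], [y] and [z = x + y] be the classes mod 2 of
   the quotient by these involutions attached to the characters by which
   [p], [w] and [q] transform.  Since [Phi] takes its values in [z]-odd vectors of
   length [n] and has no zero, [z ^ n = 0]; in the same way the coordinate
   functions give [y ^ j.+1 = 0] and [x ^ d z ^ d = 0], while [x ^ d.-1 y ^ j z ^ d]
   is the top class.  As [j] is a power of 2 and [m] is odd this forces
   [z ^ (2 d - 1 + j)] to be the top class as well, a contradiction.

   The quotient is obtained from a cube of dimension [2 d - 1 + j] by gluing its
   boundary, and the classes are computed with cochains on a fine cubical
   subdivision.  The class of a character is represented by the coboundary of
   the sign of any function with that character, so a cup product of such
   classes lives on cells where all the functions change sign; on a fine grid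
   these functions are then all small at the same point. *)

(** * Cubical cochains modulo 2 *)

(** Here [bool] is the field with two elements: [+] is exclusive or and [*] is conjunction. *)
Lemma addbb2 (x : bool) : x + x = 0. Proof. by case: x. Qed.

Lemma sum_sym_diag0 n (g : 'I_n -> 'I_n -> bool) :
  (forall i k, g i k = g k i) -> (forall i, g i i = 0) ->
  \sum_i \sum_k g i k = 0.
Proof.
move=> gC g0.
have -> : \sum_i \sum_k g i k =
    \sum_(i < n) \sum_(k < n | (k < i)%N) g i k +
    \sum_(i < n) \sum_(k < n | (i < k)%N) g i k.
  rewrite -big_split; apply: eq_bigr => i _ /=.
  rewrite (bigID (fun k : 'I_n => (k < i)%N)) /=; congr (_ + _).
  rewrite (bigD1 i) ?ltnn //= g0 add0r; apply: eq_bigl => k.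
  by rewrite -leqNgt ltn_neqAle andbC eq_sym.
rewrite [X in _ + X](exchange_big_dep xpredT) //=.
rewrite [X in _ + X](eq_bigr (fun i : 'I_n => \sum_(k < n | (k < i)%N) g i k)).
  by rewrite addbb2.
by move=> i _; apply: eq_bigr => k _; rewrite gC.
Qed.

Section Cochains.
Context {n : nat}.
Notation X := {ffun 'I_n -> int}.
Implicit Types (v w : X) (c s t : X -> bool).

Definition oddz (a : int) : bool := odd `|a|%N.

Definition upd v i a : X := [ffun k => if k == i then a else v k].

(* A grid point stands for the cell of the cubical subdivision of which it is
   the centre: its odd coordinates are the directions of the cell. *)
Definition cobd c v : bool :=
  \sum_i (if oddz (v i) then c (upd v i (v i - 1)) + c (upd v i (v i + 1)) else 0).

Definition face w v : Prop :=
  exists2 i, oddz (v i) & w = upd v i (v i - 1) \/ w = upd v i (v i + 1).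

Lemma cobd_ext c c' v :
  (forall w, face w v -> c w = c' w) -> cobd c v = cobd c' v.
Proof.
move=> cc'; apply: eq_bigr => i _; case: ifP => // ov.
by rewrite !cc' //; exists i => //; [right|left].
Qed.

Lemma cobdD c c' v : cobd (fun w => c w + c' w) v = cobd c v + cobd c' v.
Proof.
rewrite /cobd -big_split; apply: eq_bigr => i _ /=.
by case: ifP => _; rewrite ?addr0 // addrACA.
Qed.

Lemma cobdM a c v : cobd (fun w => a * c w) v = a * cobd c v.
Proof.
rewrite /cobd mulr_sumr; apply: eq_bigr => i _ /=.
by case: ifP => _; rewrite ?mulr0 // mulrDr.
Qed.

Lemma cobd0 v : cobd (fun=> 0) v = 0.
Proof. by rewrite /cobd big1 // => i _; case: ifP; rewrite ?addr0. Qed.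

Lemma cobd_true c v : cobd c v -> exists2 w, face w v & c w.
Proof.
apply: contraPP => /= h cv.
have : cobd c v = 0.
  rewrite -(cobd0 v); apply: cobd_ext => w wv.
  by apply/negbTE/negP => cw; apply: h; exists w.
by rewrite cv.
Qed.

Lemma updE v i a k : upd v i a k = if k == i then a else v k.
Proof. by rewrite ffunE. Qed.

Lemma updC v i k a b : i != k -> upd (upd v i a) k b = upd (upd v k b) i a.
Proof.
move=> ik; apply/ffunP => l; rewrite !updE.
by case: eqP => // ->; rewrite eq_sym (negbTE ik).
Qed.

Lemma oddzS a : oddz (a + 1) = ~~ oddz a. Proof. rewrite /oddz; lia. Qed.
Lemma oddzP a : oddz (a - 1) = ~~ oddz a. Proof. rewrite /oddz; lia. Qed.
Lemma oddzN a : oddz (- a) = oddz a. Proof. rewrite /oddz; lia. Qed.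

(** Two steps in distinct directions commute, so each face of codimension 2 is counted twice; a
    second step in the same direction is excluded because the first one makes that coordinate
    even. *)
Lemma cobd_cobd c v : cobd (cobd c) v = 0.
Proof.
pose g i k : bool := if [&& oddz (v i), oddz (v k) & i != k] then
   (c (upd (upd v i (v i - 1)) k (v k - 1)) +
    c (upd (upd v i (v i - 1)) k (v k + 1))) +
   (c (upd (upd v i (v i + 1)) k (v k - 1)) +
    c (upd (upd v i (v i + 1)) k (v k + 1))) else 0.
rewrite -(@sum_sym_diag0 n g); first last.
- by move=> i; rewrite /g eqxx /= !andbF.
- move=> i k; rewrite /g; case: (eqVneq i k) => [-> //|ik].
  have ki := ik; rewrite eq_sym in ki.
  rewrite /= !andbT andbC; case: ifP => // _.
  by rewrite !(updC v _ _ _ _ ki) addrACA.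
apply: eq_bigr => i _; rewrite /g; case: ifPn => oi /=; last by rewrite big1.
rewrite /cobd -big_split; apply: eq_bigr => k _ /=; rewrite !updE.
case: (eqVneq k i) => [->|ki]; first by rewrite oddzS oddzP oi andbF addr0.
by rewrite andbT; case: ifP; rewrite ?addr0.
Qed.

(* The cup product of [c] with the coboundary of the 0-cochain [s]. *)
Definition cup s c v : bool := cobd (fun w => c w * (s w + s v)) v.

(** For a cocycle [c] this is the coboundary of [c * s]; it can still be a nontrivial class after
    gluing, as [c * s] need not be invariant. *)
Lemma cupE s c v : cup s c v = cobd (fun w => c w * s w) v + s v * cobd c v.
Proof.
rewrite -cobdM -cobdD; apply: cobd_ext => w _.
by rewrite mulrDr [c w * s v]mulrC.
Qed.

Lemma cup_ext s c c' v :
  (forall w, face w v -> c w = c' w) -> cup s c v = cup s c' v.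
Proof. by move=> cc'; apply: cobd_ext => w /cc' ->. Qed.

Lemma cupD s c c' v : cup s (fun w => c w + c' w) v = cup s c v + cup s c' v.
Proof. by rewrite /cup -cobdD; apply: cobd_ext => w _; rewrite mulrDl. Qed.

Lemma cupDl s t c v : cup (fun w => s w + t w) c v = cup s c v + cup t c v.
Proof.
by rewrite /cup -cobdD; apply: cobd_ext => w _; rewrite -mulrDr addrACA.
Qed.

Lemma cobd_cup s c v : cobd (cup s c) v = cup s (cobd c) v.
Proof.
rewrite (cobd_ext _ (fun w => cobd (fun w => c w * s w) w + s w * cobd c w)).
  rewrite cobdD cobd_cobd add0r cupE cobd_cobd mulr0 addr0.
  by apply: cobd_ext => w _; rewrite mulrC.
by move=> w _; rewrite cupE.
Qed.

(** Iterated, this yields a chain of nested cells along which the successive functions change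
    sign. *)
Lemma cup_true s c v : cup s c v -> exists w, [/\ face w v, c w & s w != s v].
Proof.
case/cobd_true => w wv cs; exists w; split=> //.
  by move: cs; case: (c w).
by move: cs; case: (s w); case: (s v); case: (c w).
Qed.

Fixpoint cups (s : nat -> X -> bool) m c : X -> bool :=
  if m is m'.+1 then cup (s m') (cups s m' c) else c.

(** * Cochains on a box with glued facets *)

Section Box.
Context {N : nat}.
Hypothesis Neven : ~~ odd N.

Definition box v := forall i, `|v i| <= N%:Z.

(** As [N] is even, an odd coordinate lies strictly between [- N] and [N], so both of its neighbours
    stay in the box. *)
Lemma box_face v w : box v -> face w v -> box w.
Proof.
move=> bv [i oi wE] k; have bi := bv i; have bk := bv k.
case: wE => ->; rewrite updE; case: eqP => _ //; move: oi bi Neven; rewrite /oddz; lia.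
Qed.

(* Two involutions of the box, indexed by [bool]: the involution [e] negates
   the coordinates in [flip e] and glues the facets [v i = N] and [v i = - N]
   for those [i] with [ty i = e]. *)
Context (ty : 'I_n -> bool) (flip : bool -> 'I_n -> bool).
Hypothesis flip_ty : forall i, flip (ty i) i.

Definition act e v : X := [ffun i => if flip e i then - v i else v i].

Definition bd e v : bool := [exists i, (ty i == e) && (`|v i| == N%:Z)].

(** Invariance is asked only on the facets glued by [e]: these are the cochains of the quotient. *)
Definition invariant c := forall e v, box v -> bd e v -> c (act e v) = c v.

Definition hasChar (chi : bool -> bool) s :=
  forall e v, box v -> bd e v -> s (act e v) = s v + chi e.

Lemma bd_face e v w : bd e v -> face w v -> bd e w.
Proof.
move=> /existsP[k /andP[tk /eqP vk]] [i oi wE]; apply/existsP; exists k.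
rewrite tk /=; have ki : (k == i) = false.
  by apply/eqP => ki; move: oi Neven; rewrite /oddz -ki; lia.
by case: wE => ->; rewrite updE ki vk.
Qed.

Lemma cobd_act c e v : cobd c (act e v) = cobd (fun w => c (act e w)) v.
Proof.
have act_upd i a : act e (upd v i a) = upd (act e v) i (if flip e i then - a else a).
  apply/ffunP => k; rewrite !ffunE; case: eqP => [->|_]; by case: ifP.
apply: eq_bigr => i _; rewrite !act_upd !ffunE.
case: (flip e i); rewrite ?oddzN //. case: (oddz (v i)) => //.
by rewrite addrC !opprD opprK.
Qed.

Lemma invariant_cup s c chi : hasChar chi s -> invariant c -> invariant (cup s c).
Proof.
move=> hs ic e v bv dv; rewrite /cup cobd_act; apply: cobd_ext => w wv.
have bw := box_face _ _ bv wv; have dw := bd_face _ _ _ dv wv.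
by rewrite ic // !hs // addrACA addbb2 addr0.
Qed.

Lemma invariantM c s : invariant c -> invariant s -> invariant (fun w => c w * s w).
Proof. by move=> ic iS e v bv dv; rewrite ic ?iS. Qed.

Lemma invariantD c s : invariant c -> invariant s -> invariant (fun w => c w + s w).
Proof. by move=> ic iS e v bv dv; rewrite ic ?iS. Qed.

Definition exact c :=
  exists R, invariant R /\ forall v, box v -> c v = cobd R v.

Definition cocycle c := invariant c /\ forall v, box v -> cobd c v = 0.

Lemma exactD c c' : exact c -> exact c' -> exact (fun w => c w + c' w).
Proof.
move=> [R [iR cR]] [R' [iR' cR']]; exists (fun w => R w + R' w); split.
  exact: invariantD.
by move=> v bv; rewrite cobdD cR // cR'.
Qed.

Lemma exact_ext c c' : (forall v, box v -> c v = c' v) -> exact c -> exact c'.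
Proof. by move=> cc' [R [iR cR]]; exists R; split=> // v bv; rewrite -cc' ?cR. Qed.

Lemma exact0 : exact (fun=> 0).
Proof. by exists (fun=> 0); split=> // v bv; rewrite cobd0. Qed.

Lemma exact_cup s c chi : hasChar chi s -> exact c -> exact (cup s c).
Proof.
move=> hs [R [iR cR]]; exists (cup s R); split; first exact: invariant_cup hs iR.
move=> v bv; rewrite cobd_cup; apply: cup_ext => w wv.
by apply: cR; exact: box_face wv.
Qed.

Lemma cocycle_cup s c chi : hasChar chi s -> cocycle c -> cocycle (cup s c).
Proof.
move=> hs [ic cc]; split; first exact: invariant_cup hs ic.
move=> v bv; rewrite cobd_cup (cup_ext _ _ (fun=> 0)).
  by rewrite /cup (cobd_ext _ (fun=> 0)) ?cobd0 // => w _; rewrite mul0r.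
by move=> w wv; apply: cc; exact: box_face wv.
Qed.

Lemma exact_cup_invariant s c : invariant s -> cocycle c -> exact (cup s c).
Proof.
move=> iS [ic cc]; exists (fun w => c w * s w); split; first exact: invariantM.
by move=> v bv; rewrite cupE cc // mulr0 addr0.
Qed.

(** The two values of [chi] cancel in [s + t], which is thus invariant: the class depends on the
    character alone. *)
Lemma exact_cup_char s t c chi : hasChar chi s -> hasChar chi t -> cocycle c ->
  exact (fun v => cup s c v + cup t c v).
Proof.
move=> hs ht zc; apply: (exact_ext (cup (fun w => s w + t w) c)).
  by move=> v _; rewrite cupDl.
apply: exact_cup_invariant => // e v bv dv.
by rewrite hs // ht // addrACA addbb2 addr0.
Qed.

(** The primitive is a kind of cup-1 product: it weights the values of [c] on the faces of [v] by
    the changes of both [s] and [t], which are invariant. *)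
Lemma exact_cupC s t c chi psi : hasChar chi s -> hasChar psi t -> cocycle c ->
  exact (fun v => cup s (cup t c) v + cup t (cup s c) v).
Proof.
move=> hs ht [ic cc].
exists (fun v => cobd (fun w => c w * ((s v + s w) * (t v + t w))) v); split.
  move=> e v bv dv; rewrite cobd_act; apply: cobd_ext => w wv.
  have bw := box_face _ _ bv wv; have dw := bd_face _ _ _ dv wv.
  rewrite ic // !hs // !ht //.
  by rewrite [X in _ * (X * _)]addrACA [X in _ * (_ * X)]addrACA !addbb2 !addr0.
move=> v bv; rewrite !cupE !cobd_cup.
have z u : cup u (cobd c) v = 0.
  rewrite /cup (cobd_ext _ (fun=> 0)) ?cobd0 // => w wv.
  by rewrite cc ?mul0r //; exact: box_face wv.
rewrite !z !mulr0 !addr0 -cobdD.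
transitivity (cobd (fun w => s w * cobd (fun w => c w * t w) w
    + t w * cobd (fun w => c w * s w) w) v).
  apply: cobd_ext => w wv; rewrite !cupE cc ?mulr0 ?addr0; last exact: box_face wv.
  by rewrite [_ * s w]mulrC [_ * t w]mulrC.
transitivity (cobd (fun w => cobd (fun w => c w * s w * t w) w +
  (s w * cobd (fun w => c w * t w) w + t w * cobd (fun w => c w * s w) w)) v).
  by rewrite [RHS]cobdD cobd_cobd add0r.
apply: cobd_ext => w wv.
(* The last summand is zero, [c] being a cocycle; it completes the expansion of the product of the
   two differences. *)
transitivity (cobd (fun w => c w * s w * t w) w +
   (s w * cobd (fun w => c w * t w) w + t w * cobd (fun w => c w * s w) w) +
   s w * t w * cobd c w).
  by rewrite cc ?mulr0 ?addr0 //; exact: box_face wv.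
rewrite -!cobdM -!cobdD; apply: cobd_ext => x _.
by case: (c x); case: (s x); case: (t x); case: (s w); case: (t w).
Qed.

(** * Integration over the glued box *)

Hypothesis N_gt0 : (0 < N)%N.

Definition topcell (b : {ffun 'I_n -> 'I_N}) : X :=
  [ffun i => (b i).*2%:Z - N%:Z + 1].

(** Evaluation on the fundamental class modulo 2. *)
Definition integral c : bool := \sum_(b : {ffun 'I_n -> 'I_N}) c (topcell b).

Lemma odd_topcell b i : oddz (topcell b i).
Proof. rewrite ffunE /oddz; move: Neven; lia. Qed.

Lemma box_topcell b : box (topcell b).
Proof. move=> i; rewrite ffunE; have := ltn_ord (b i); lia. Qed.

Lemma integralD c c' : integral (fun v => c v + c' v) = integral c + integral c'.
Proof. exact: big_split. Qed.

(** Stokes' formula: the sum along each line in direction [i] telescopes to its two ends, and the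
    gluing of type [ty i] matches the two end facets, which cancel modulo 2. *)
Lemma integral_cobd c : invariant c -> integral (cobd c) = 0.
Proof.
move=> ic; pose G b i (t : nat) := c (upd (topcell b) i (t.*2%:Z - N%:Z)).
have -> : integral (cobd c) =
    \sum_i \sum_(b : {ffun 'I_n -> 'I_N}) (G b i (b i) + G b i (b i).+1).
  rewrite exchange_big; apply: eq_bigr => b _; apply: eq_bigr => i _.
  rewrite odd_topcell ffunE /G; congr (c (upd _ _ _) + c (upd _ _ _)); lia.
rewrite big1 // => i _.
pose o := Ordinal N_gt0.
pose updb (b : {ffun 'I_n -> 'I_N}) (t : 'I_N) : {ffun 'I_n -> 'I_N} :=
  [ffun k => if k == i then t else b k].
have Gu b (t : 'I_N) u : G (updb b t) i u = G b i u.
  congr c; apply/ffunP => k; rewrite !ffunE; by case: eqP.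
rewrite (partition_big (fun b => updb b o) (fun b => b i == o)) /=; last first.
  by move=> b _; rewrite ffunE eqxx.
rewrite (eq_bigr (fun b => G b i 0%N + G b i N)); last first.
  move=> b /eqP bo.
  rewrite (reindex_onto (updb b) (fun b' => b' i)) /=; last first.
    move=> b' /eqP <-; apply/ffunP => k; rewrite !ffunE.
    by case: eqP => // ->.
  rewrite (eq_bigl xpredT); last first.
    move=> t; rewrite ffunE eqxx eqxx andbT; apply/eqP/ffunP => k.
    by rewrite !ffunE; case: eqP => // ->.
  under eq_bigr do rewrite ffunE eqxx !Gu.
  transitivity (\sum_(0 <= p < N) (G b i p.+1 - G b i p)).
    by rewrite big_mkord; apply: eq_bigr => t _; rewrite addrC.
  by rewrite telescope_sumr // addrC.
rewrite big_split /=.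
(* The involution on the coordinates other than [i], read on indices: reversing an index negates the
   coordinate of the centre. *)
pose r (b : {ffun 'I_n -> 'I_N}) : {ffun 'I_n -> 'I_N} :=
  [ffun k => if (k != i) && flip (ty i) k then rev_ord (b k) else b k].
have rK : involutive r.
  move=> b; apply/ffunP => k; rewrite !ffunE.
  by case: (_ && _); rewrite ?rev_ordK.
rewrite [X in _ + X](reindex_inj (inv_inj rK)) /=.
rewrite [X in _ + X](eq_big (fun b : {ffun 'I_n -> 'I_N} => b i == o) (fun b : {ffun 'I_n -> 'I_N} => G b i 0%N)).
- by rewrite addbb2.
- by move=> b; rewrite ffunE eqxx.
- move=> b _; rewrite /G -(ic (ty i)); first last.
  + by apply/existsP; exists i; rewrite eqxx ffunE eqxx /=; apply/eqP; lia.
  + move=> k; rewrite ffunE; case: eqP => _; first by lia.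
    exact: box_topcell.
  congr c; apply/ffunP => k; rewrite !ffunE.
  case: (eqVneq k i) => [->|ki] /=; first by rewrite flip_ty; lia.
  by case: (flip _ k) => //=; have := ltn_ord (b k); lia.
Qed.

Lemma integral_exact c : exact c -> integral c = 0.
Proof.
move=> [R [iR cR]]; rewrite -(integral_cobd _ iR); apply: eq_bigr => b _.
by rewrite cR //; exact: box_topcell.
Qed.

(* The only top cell all of whose steps cross the zero of the corresponding
   coordinate is the one just above the origin. *)
Lemma integral_cups_coords (s : nat -> X -> bool) :
  (forall (i : 'I_n) v, box v -> 0 < v i -> s i v) ->
  (forall (i : 'I_n) v, box v -> v i < 0 -> ~~ s i v) ->
  (forall (i : 'I_n) v, (forall k : 'I_n, (k < i)%N -> v k = 1) ->
     (forall k : 'I_n, (i <= k)%N -> v k = 0) -> ~~ s i v) ->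
  integral (cups s n (fun=> true)) = true.
Proof.
move=> sp sn s0.
(* On cells spanned by the first [m] directions and centred at 0 in the others, the partial product
   is the indicator of a single cell. In the inductive step only the direction [i] contributes, as
   [s i] is constant along the others. *)
have key m v : (m <= n)%N -> box v -> (forall k : 'I_n, (k < m)%N -> oddz (v k)) ->
    (forall k : 'I_n, (m <= k)%N -> v k = 0) ->
    cups s m (fun=> true) v = [forall k : 'I_n, (k < m)%N ==> (v k == 1)].
  elim: m v => [v _ _ _ _|m IH v mn bv vo v0] /=; first by symmetry; apply/forallP.
  pose i := Ordinal mn.
  have oi : oddz (v i) by apply: vo => /=.
  rewrite /cup /cobd (bigD1 i) //= big1 => [|k ki]; last first.
    case: ifP => // ok.
    suff z a : box (upd v k a) ->
        cups s m xpredT (upd v k a) * (s i (upd v k a) + s i v) = 0.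
      by rewrite !z ?addr0 //; apply: box_face bv _; exists k => //; [right|left].
    move=> ba; suff -> : s i (upd v k a) = s i v by rewrite addbb2 mulr0.
    have eqi : upd v k a i = v i by rewrite updE eq_sym (negbTE ki).
    case: (ltgtP (v i) 0) => [vi|vi|vi].
    - by rewrite (negbTE (sn _ _ bv vi)) (negbTE (sn _ _ ba _)) // eqi.
    - by rewrite (sp _ _ bv vi) (sp _ _ ba) // eqi.
    - by move: oi; rewrite vi.
  rewrite oi addr0.
  have bu a : a = v i - 1 \/ a = v i + 1 -> box (upd v i a).
    move=> aE; apply: box_face bv _; exists i => //.
    by case: aE => ->; [left|right].
  have far a : a = v i - 1 \/ a = v i + 1 -> a != 0 ->
      cups s m xpredT (upd v i a) * (s i (upd v i a) + s i v) = 0.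
    move=> aE a0; suff -> : s i (upd v i a) = s i v by rewrite addbb2 mulr0.
    have ba := bu _ aE.
    have ua : upd v i a i = a by rewrite updE eqxx.
    case: (ltgtP (v i) 0) => [vi|vi|vi].
    - by rewrite (negbTE (sn _ _ bv vi)) (negbTE (sn _ _ ba _)) // ua; lia.
    - by rewrite (sp _ _ bv vi) (sp _ _ ba) // ua; lia.
    - by move: oi; rewrite vi.
  have near a : a = v i - 1 \/ a = v i + 1 -> a = 0 ->
      cups s m xpredT (upd v i a) * (s i (upd v i a) + s i v) =
      [forall k : 'I_n, (k < m.+1)%N ==> (v k == 1)].
    move=> aE a0; rewrite IH; first last.
    - move=> k mk; rewrite updE; case: (eqVneq k i) => // ki; apply: v0.
      by rewrite ltn_neqAle mk andbT eq_sym.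
    - move=> k km; rewrite updE; case: eqP => [ki|_].
        by move: km; rewrite ki /= ltnn.
      by apply: vo; exact: ltnW.
    - exact: bu.
    - exact: ltnW.
    have -> : [forall k : 'I_n, (k < m)%N ==> (upd v i a k == 1)] =
              [forall k : 'I_n, (k < m)%N ==> (v k == 1)].
      apply: eq_forallb => k; rewrite updE; case: (k =P i) => // ->.
      by rewrite /= ltnn.
    (* At the neighbour with [i]-th coordinate 0 the value is false by [s0], as on the side of
       [- 1]; hence only the cell at 1 sees a change. *)
    case: (boolP [forall k : 'I_n, (k < m)%N ==> (v k == 1)]) => [/forallP h|h].
      rewrite mul1r (negbTE (s0 _ _ _ _)) ?add0r; first last.
      + move=> k /= mk; rewrite updE; case: (eqVneq k i) => // ki; apply: v0.
        by rewrite ltn_neqAle mk andbT eq_sym.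
      + move=> k /= km; rewrite updE; case: eqP => [ki|_].
          by move: km; rewrite ki /= ltnn.
        by apply/eqP; have := h k; rewrite km.
      case: (ltgtP (v i) 0) => [vi|vi|vi].
      + rewrite (negbTE (sn _ _ bv vi)); symmetry; apply/negbTE/forallPn.
        by exists i; rewrite negb_imply /= ltnSn; apply/eqP; lia.
      + rewrite sp //; symmetry; apply/forallP => k; apply/implyP.
        rewrite ltnS leq_eqVlt => /orP[/eqP km|km]; last by have := h k; rewrite km.
        have -> : k = i by apply: val_inj.
        by apply/eqP; lia.
      + by move: oi; rewrite vi.
    rewrite mul0r; symmetry; apply/negbTE; apply: contra h => /forallP h.
    apply/forallP => k; apply/implyP => km; have := h k; rewrite (ltn_trans km) //.
  have vn1 : ~ (v i = 1) -> [forall k : 'I_n, (k < m.+1)%N ==> (v k == 1)] = false.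
    move=> vi; apply/negbTE/forallPn; exists i; rewrite negb_imply /= ltnSn.
    exact/eqP.
  case: (eqVneq (v i) 1) => [vi|vi].
    rewrite near ?far ?addr0 //; rewrite ?vi //; [by right|by left].
  case: (eqVneq (v i) (-1)) => [vi'|vi'].
    rewrite far ?near ?add0r //; rewrite ?vi' //; [by right|by left].
  rewrite !far ?addr0 ?vn1 //; [exact/eqP|by right| |by left|];
    apply/eqP; move/eqP: vi; move/eqP: vi'; lia.
have N2 : (N./2 < N)%N by move: N_gt0; lia.
pose b0 : {ffun 'I_n -> 'I_N} := [ffun=> Ordinal N2].
have ev b : cups s n xpredT (topcell b) = (b == b0).
  rewrite key //; first last.
  - by move=> k; rewrite leqNgt ltn_ord.
  - by move=> k _; exact: odd_topcell.
  - exact: box_topcell.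
  apply/forallP/eqP => [h|-> k].
    apply/ffunP => k; have := h k; rewrite ltn_ord /= !ffunE => /eqP bk.
    by apply: val_inj => /=; move: bk Neven; lia.
  by rewrite !ffunE /= ltn_ord /=; apply/eqP; move: Neven; lia.
rewrite /integral (bigD1 b0) //= big1 ?addr0 => [|b /negbTE bb].
  by rewrite ev eqxx.
by rewrite ev bb.
Qed.

Lemma cocycle1 : cocycle (fun=> true).
Proof.
split=> // v _; rewrite /cobd big1 // => i _; by case: ifP.
Qed.

Lemma cocycle_iter s chi m c : hasChar chi s -> cocycle c -> cocycle (iter m (cup s) c).
Proof. by move=> hs zc; elim: m => //= m IH; exact: cocycle_cup hs IH. Qed.

Lemma exact_iter s chi m c : hasChar chi s -> exact c -> exact (iter m (cup s) c).
Proof. by move=> hs zc; elim: m => //= m IH; exact: exact_cup hs IH. Qed.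

Lemma iter_cupD s m c c' v :
  iter m (cup s) (fun w => c w + c' w) v = iter m (cup s) c v + iter m (cup s) c' v.
Proof.
elim: m v => //= m IH v.
by rewrite -cupD; apply: cup_ext => w _.
Qed.

Lemma exact_trans c c' c'' : exact (fun v => c v + c' v) ->
  exact (fun v => c' v + c'' v) -> exact (fun v => c v + c'' v).
Proof.
move=> h h'; apply: exact_ext (exactD _ _ h h') => v _.
by rewrite addrA -[_ + c' v + c' v]addrA addbb2 addr0.
Qed.

Lemma exact_iterC s t chi psi m c : hasChar chi s -> hasChar psi t -> cocycle c ->
  exact (fun v => cup s (iter m (cup t) c) v + iter m (cup t) (cup s c) v).
Proof.
move=> hs ht zc; elim: m => [|m IH] /=.
  by apply: exact_ext exact0 => v _; rewrite addbb2.
apply: exact_trans (exact_cupC _ _ _ _ _ hs ht (cocycle_iter _ _ m _ ht zc)) _.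
by apply: exact_ext (exact_cup _ _ _ ht IH) => v _; rewrite cupD.
Qed.

Lemma exact_congr_iter s chi m c c' : hasChar chi s ->
  exact (fun v => c v + c' v) ->
  exact (fun v => iter m (cup s) c v + iter m (cup s) c' v).
Proof.
move=> hs h; apply: exact_ext (exact_iter _ _ m _ hs h) => v _.
exact: iter_cupD.
Qed.

(** Replacing the factors one at a time: a power of a class may be computed with a different
    representative in each factor. *)
Lemma exact_cups_iter (s : nat -> X -> bool) r chi m c :
  (forall i, (i < m)%N -> hasChar chi (s i)) -> hasChar chi r -> cocycle c ->
  exact (fun v => cups s m c v + iter m (cup r) c v).
Proof.
move=> hs hr zc; elim: m hs => [|m IH] hs /=.
  by apply: exact_ext exact0 => v _; rewrite addbb2.
have {}IH := IH (fun i im => hs i (ltnW im)).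
have hm := hs m (ltnSn m).
apply: (exact_trans _ (cup (s m) (iter m (cup r) c))).
  by apply: exact_ext (exact_cup _ _ _ hm IH) => v _; rewrite cupD.
exact: exact_cup_char hm hr (cocycle_iter _ _ _ _ hr zc).
Qed.

Lemma cupsD (s : nat -> X -> bool) p q c :
  cups s (p + q) c = cups (fun i => s (p + i)%N) q (cups s p c).
Proof. by elim: q => [|q IH]; rewrite ?addn0 // addnS /= IH. Qed.

Lemma eq_cups (s s' : nat -> X -> bool) m c :
  (forall i, (i < m)%N -> s i = s' i) -> cups s m c = cups s' m c.
Proof.
elim: m => //= m IH ss'; rewrite ss' // IH // => i im.
by apply: ss'; exact: ltnW.
Qed.

Lemma integral_eq c c' : exact (fun v => c v + c' v) -> integral c = integral c'.
Proof.
move/integral_exact; rewrite integralD.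
by case: (integral c); case: (integral c').
Qed.

(** * The subring generated by two characters *)

Section CharacterAlgebra.
Context (x y : X -> bool) (cx cy : bool -> bool).
Hypotheses (hx : hasChar cx x) (hy : hasChar cy y).

Let z v := x v + y v.

Let hz : hasChar (fun e => cx e + cy e) z.
Proof. by move=> e v bv dv; rewrite /z hx // hy // addrACA. Qed.

Definition monom a b k : X -> bool :=
  iter a (cup x) (iter b (cup y) (iter k (cup z) (fun=> true))).

Let zmonom0 k : cocycle (iter k (cup z) (fun=> true)).
Proof. exact: cocycle_iter hz cocycle1. Qed.

Let zmonom1 b k : cocycle (iter b (cup y) (iter k (cup z) (fun=> true))).
Proof. exact: cocycle_iter hy (zmonom0 k). Qed.

Let zmonom a b k : cocycle (monom a b k).
Proof. exact: cocycle_iter hx (zmonom1 b k). Qed.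

(** The relation [x = y + z] modulo 2, the new factor being moved to its place by commutativity up
    to exact cochains. *)
Lemma integral_monomS a b k : integral (monom a.+1 b k) =
  integral (monom a b k.+1) + integral (monom a b.+1 k).
Proof.
have -> : integral (monom a.+1 b k) =
    integral (cup z (monom a b k)) + integral (cup y (monom a b k)).
  rewrite -integralD; apply: eq_bigr => v _.
  by rewrite cupDl -addrA addbb2 addr0.
congr (_ + _); apply: integral_eq.
  apply: exact_trans (exact_iterC _ _ _ _ a _ hz hx (zmonom1 b k)) _.
  exact: exact_congr_iter hx (exact_iterC _ _ _ _ b _ hz hy (zmonom0 k)).
exact: exact_iterC _ _ _ _ a _ hy hx (zmonom1 b k).
Qed.

(** The functions [s i] give a representative of [y ^ m] times any class that is zero cell by
    cell. *)
Lemma integral_monom_y (s : nat -> X -> bool) m a b k :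
  (forall i, (i < m)%N -> hasChar cy (s i)) ->
  (forall c v, box v -> cups s m c v = 0) -> (m <= b)%N ->
  integral (monom a b k) = 0.
Proof.
move=> hs s0 mb; apply: integral_exact; apply: exact_iter hx _.
rewrite -(subnKC mb) iterD; set c := iter (b - m) _ _.
have zc : cocycle c by exact: zmonom1.
apply: exact_ext (exact_cups_iter _ _ _ _ _ hs hy zc) => v bv.
by rewrite s0 // add0r.
Qed.

Lemma integral_monom_z (s : nat -> X -> bool) m k :
  (forall i, (i < m)%N -> hasChar (fun e => cx e + cy e) (s i)) ->
  (forall c v, box v -> cups s m c v = 0) -> (m <= k)%N ->
  integral (monom 0 0 k) = 0.
Proof.
move=> hs s0 mk; apply: integral_exact.
rewrite /monom /= -(subnK mk) iterD; apply: exact_iter hz _.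
apply: exact_ext (exact_cups_iter _ _ _ _ _ hs hz cocycle1) => v bv.
by rewrite s0 // add0r.
Qed.

Lemma integral_monom_xz (s t : nat -> X -> bool) p q a b k :
  (forall i, (i < p)%N -> hasChar cx (s i)) ->
  (forall i, (i < q)%N -> hasChar (fun e => cx e + cy e) (t i)) ->
  (forall c v, box v -> cups s p (cups t q c) v = 0) ->
  (p <= a)%N -> (q <= k)%N -> integral (monom a b k) = 0.
Proof.
move=> hs ht st0 pa qk; apply: integral_exact.
set M := monom (a - p) b (k - q).
have zM : cocycle M by exact: zmonom.
(* The powers of [z] taken out of the monomial are commuted back past those of [x] and [y]. *)
have eM r : exact (fun v => iter r (cup z) M v + monom (a - p) b (r + (k - q)) v).
  elim: r => [|r IH].
    by apply: exact_ext exact0 => v _; rewrite addbb2.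
  rewrite addSn /=.
  apply: (exact_trans _ (cup z (monom (a - p) b (r + (k - q))))).
    by apply: exact_ext (exact_cup _ _ _ hz IH) => v _; rewrite cupD.
  apply: exact_trans (exact_iterC _ _ _ _ _ _ hz hx (zmonom1 b _)) _.
  exact: exact_congr_iter hx (exact_iterC _ _ _ _ b _ hz hy (zmonom0 _)).
have eP : exact (fun v => iter p (cup x) (iter q (cup z) M) v + monom a b k v).
  apply: exact_ext (exact_congr_iter _ _ p _ _ hx (eM q)) => v _.
  by rewrite subnKC // /monom -iterD subnKC.
have h1 := exact_cups_iter _ _ _ _ _ ht hz zM.
have zt : cocycle (cups t q M).
  elim: (q) ht => //= r IH ht.
  apply: cocycle_cup (ht r (ltnSn r)) _; apply: IH => i ir.
  by apply: ht; exact: ltnW.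
have h2 := exact_cups_iter _ _ _ _ _ hs hx zt.
have h3 := exact_congr_iter _ _ p _ _ hx h1.
have h := exact_trans _ _ _ (exact_trans _ _ _ h2 h3) eP.
by apply: exact_ext h => v bv; rewrite st0 // add0r.
Qed.

Lemma integral_monom_cups (s : nat -> X -> bool) a b k :
  (forall i, (i < k)%N -> hasChar (fun e => cx e + cy e) (s i)) ->
  (forall i, (i < b)%N -> hasChar cy (s (k + i)%N)) ->
  (forall i, (i < a)%N -> hasChar cx (s (k + b + i)%N)) ->
  integral (cups s (k + b + a) (fun=> true)) = integral (monom a b k).
Proof.
move=> hsz hsy hsx; apply: integral_eq.
have cocycle_cups (t : nat -> X -> bool) chi m c :
    (forall i, (i < m)%N -> hasChar chi (t i)) -> cocycle c -> cocycle (cups t m c).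
  move=> ht zc; elim: m ht => //= m IH ht.
  apply: cocycle_cup (ht m (ltnSn m)) _; apply: IH => i im.
  by apply: ht; exact: ltnW.
rewrite !cupsD.
have z1 := cocycle_cups _ _ _ _ hsz cocycle1.
have z2 := cocycle_cups _ _ _ _ hsy z1.
apply: exact_trans (exact_cups_iter _ _ _ _ _ hsx hx z2) _.
apply: exact_congr_iter hx _.
apply: exact_trans (exact_cups_iter _ _ _ _ _ hsy hy z1) _.
apply: exact_congr_iter hy _.
exact: exact_cups_iter hsz hz cocycle1.
Qed.

End CharacterAlgebra.
End Box.
End Cochains.

(* In [F_2[x, y]] with [z = x + y], [d = m j] and [j = 2 ^ k], the relation
   [y ^ j.+1 = 0] gives [x ^ d = z ^ d + z ^ (d - j) y ^ j], so that
   [x ^ d z ^ d = 0] forces [z ^ (2 d) = z ^ (2 d - j) y ^ j]. *)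
Lemma monomial_count (e : nat -> nat -> nat -> bool) (m k : nat) :
  let j := (2 ^ k)%N in let d := (m * j)%N in
  odd m ->
  (forall a b c, e a.+1 b c = e a b c.+1 + e a b.+1 c) ->
  (forall a b c, (j < b)%N -> e a b c = 0) ->
  (forall a b c, (d <= a)%N -> (d <= c)%N -> e a b c = 0) ->
  e 0%N 0%N (d + j + d.-1)%N = e d.-1 j d.
Proof.
move=> j d om eS ey exz.
(* The Frobenius identity: [x ^ q = z ^ q + y ^ q] for [q = 2 ^ i]. *)
have frob i a b c : e (a + 2 ^ i)%N b c = e a b (c + 2 ^ i)%N + e a (b + 2 ^ i)%N c.
  elim: i a b c => [|i IH] a b c; first by rewrite !addn1.
  have -> : (2 ^ i.+1 = 2 ^ i + 2 ^ i)%N by rewrite expnS mul2n addnn.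
  by rewrite !addnA !IH addrA -(addrA (e _ _ _)) addbb2 addr0.
(* As [y ^ (2 j) = 0], the binomial expansion of the [p]-th power of [z ^ j + y ^ j] stops at its
   linear term. *)
have pw p a c : e (a + p * j)%N 0%N c =
    e a 0%N (c + p * j)%N + (odd p : bool) * e a j (c + p.-1 * j)%N.
  elim: p a c => [|p IH] a c; first by rewrite !addn0 mul0r addr0.
  have j0 : (0 < j)%N by rewrite expn_gt0.
  have y2 c' : e a (j + j)%N c' = 0 by apply: ey; lia.
  rewrite mulSn addnA IH !frob add0n -/j y2 oddS succnK addr0.
  rewrite -!addnA [(p * j + j)%N]addnC.
  case: p {IH} => [|p]; first by rewrite !mul0n !mul0r !addn0 !addr0 mul1r.
  rewrite succnK [(p * j + j)%N]addnC -mulSn.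
  by case: (odd p.+1); rewrite /= ?mul0r ?mul1r ?addr0 // -addrA addbb2 addr0.
(* Since [y ^ j.+1 = 0], the classes [x] and [z] agree after multiplication by [y ^ j]. *)
have top a c : e a j c = e 0%N j (c + a)%N.
  elim: a c => [|a IH] c; first by rewrite addn0.
  by rewrite eS (ey _ j.+1) // addr0 IH addSnnS.
have j0 : (0 < j)%N by rewrite expn_gt0.
have m0 : (0 < m)%N by case: (m) om.
have jd : (j <= d)%N by rewrite leq_pmull.
have := pw m 0%N (d.-1 + j)%N; rewrite om mul1r add0n exz; first last.
- by lia.
- by [].
rewrite (top d.-1).
have -> : (d.-1 + j + m * j = d + j + d.-1)%N by rewrite -/d; lia.
have -> : (d.-1 + j + m.-1 * j = d + d.-1)%N.
  by rewrite -addnA -mulSn prednK // addnC.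
by case: (e _ _ (d + j + d.-1)%N); case: (e _ _ (d + d.-1)%N).
Qed.

(** * Signs of continuous functions on a fine grid *)

Lemma continuous_row (R : realType) (T : topologicalType) n (F : T -> 'rV[R]_n) :
  (forall i, continuous (fun x => F x ord0 i)) -> continuous F.
Proof.
move=> cF x; apply/cvg_ballP => e e0.
have h : \forall y \near x, forall i, ball (F x ord0 i) e (F y ord0 i).
  by apply: filter_forall => i; have /cvg_ballP := cF i x; apply.
near=> y; split=> // k i; rewrite ord1.
by move: i; near: y.
Unshelve. all: by end_near. Qed.

Lemma continuous_sumR (R : realType) (T : topologicalType) (I : Type) (r : seq I)
    (P : pred I) (F : I -> T -> R) :
  (forall i, P i -> continuous (F i)) -> continuous (fun x => \sum_(i <- r | P i) F i x).
Proof. by apply: continuous_big; exact: add_continuous. Qed.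

Lemma continuous_prodR (R : realType) (T : topologicalType) (I : Type) (r : seq I)
    (P : pred I) (F : I -> T -> R) :
  (forall i, P i -> continuous (F i)) -> continuous (fun x => \prod_(i <- r | P i) F i x).
Proof. by apply: continuous_big; exact: mul_continuous. Qed.

Definition unit_cube (R : realType) n : set 'rV[R]_n :=
  [set x | forall i, `|x ord0 i| <= 1].

Lemma compact_unit_cube (R : realType) n : compact (unit_cube R n).
Proof.
have -> : unit_cube R n = [set x : 'rV[R]_n | forall i, `[-1, 1]%classic (x ord0 i)].
  by apply/seteqP; split=> x h i; have := h i; rewrite /= in_itv /= ler_norml.
exact: (@rV_compact R n (fun=> `[-1, 1]%classic) (fun=> @segment_compact R _ _)).
Qed.

Lemma unif_continuous_unit_cube (R : realType) n (g : 'rV[R]_n -> R) (e : R) :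
  continuous g -> 0 < e ->
  \forall N \near \oo, forall x y : 'rV[R]_n, unit_cube R n x ->
    (forall i, `|x ord0 i - y ord0 i| <= N%:R^-1) -> `|g x - g y| <= e.
Proof.
move=> cg e0.
pose P (N : nat) (x : 'rV[R]_n) := forall y : 'rV[R]_n,
  (forall i, `|x ord0 i - y ord0 i| <= N%:R^-1) -> `|g x - g y| <= e.
have /compact_near_coveringP /(_ nat \oo P _) := compact_unit_cube R n.
have h : forall x, unit_cube R n x -> \forall x' \near x & N \near \oo, P N x'.
  move=> x _.
  have /cvgrPdist_lt /(_ (e / 2)) := cg x.
  move=> /(_ (divr_gt0 e0 (ltr0n _ 2))) /nbhs_ballP[r /= r0 xr].
  have r2 : 0 < r / 2 by rewrite divr_gt0.
  near=> x' N => y xy.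
  have N0 : (0 < N)%N by near: N; exact: nbhs_infty_gt.
  have N2 : N%:R^-1 < r / 2.
    rewrite invf_plt ?posrE ?ltr0n //.
    near: N; exact: nbhs_infty_gtr.
  have [_ x'r] : ball x (r / 2) x' by near: x'; exact: nbhsx_ballx.
  have b1 : `|g x - g x'| < e / 2.
    apply: xr; split=> // i k; apply: le_ball (x'r i k).
    by lra.
  have b2 : `|g x - g y| < e / 2.
    apply: xr; split=> // i k; rewrite ord1.
    have := x'r ord0 k; have := xy k; rewrite /ball /= => h1 h2.
    rewrite (splitr r); apply: le_lt_trans (ler_distD (x' ord0 k) _ _) _.
    by rewrite ltrD // (le_lt_trans h1).
  rewrite ltW // (splitr e) distrC.
  apply: le_lt_trans (ler_distD (g x) _ _) _.
  by rewrite [`|g y - _|]distrC ltrD.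
move=> /(_ h); apply: filterS => N hN x y xc; exact: hN.
Unshelve. all: by end_near. Qed.

Lemma common_zero_gap (R : realType) n m (g : nat -> 'rV[R]_n -> R) :
  (forall i, continuous (g i)) -> (forall x, exists2 i, (i < m)%N & g i x != 0) ->
  exists2 e : R, 0 < e &
    forall x, unit_cube R n x -> exists2 i, (i < m)%N & m%:R * e < `|g i x|.
Proof.
move=> cg g0.
pose G x := \sum_(i < m) `|g i x|.
have cG : continuous G.
  apply: continuous_sumR => i _ x.
  by apply: continuous_comp; [exact: cg|exact: norm_continuous].
have /(_ _)[] := @EVT_min_rV R n G (unit_cube R n) _ (@compact_unit_cube R n).
- by exists 0 => i; rewrite mxE normr0.
- exact: continuous_subspaceT.
move=> c cc Gc.
have Gc0 : 0 < G c.
  have [i im gi] := g0 c; rewrite /G (bigD1 (Ordinal im)) //=.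
  by rewrite ltr_pwDl ?normr_gt0 // sumr_ge0.
have M0 : (0 : R) < (m * m + 1)%:R by rewrite ltr0n addn1.
(* If all [m] values were at most [m * e], their sum would be at most [m * m * e], which is less
   than the minimum [G c]. *)
exists (G c / (m * m + 1)%:R); first exact: divr_gt0.
move=> x xc; apply: contrapT => h.
have : G x <= \sum_(i < m) (m%:R * (G c / (m * m + 1)%:R)).
  apply: ler_sum => i _; rewrite leNgt; apply/negP => hi; apply: h.
  by exists i.
rewrite sumr_const card_ord -[_ *+ m]mulr_natl => hG.
have := le_trans (Gc x (mem_set xc)) hG.
rewrite mulrA -natrM mulrCA ler_pMr // ler_pdivlMr // mul1r ler_nat.
by rewrite addn1 ltnn.
Qed.

Section SignFunctions.
Context {R : realType} {n : nat} (N : nat).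
Notation X := {ffun 'I_n -> int}.

Definition pos (v : X) : 'rV[R]_n := \row_i ((v i)%:~R / N%:R).

(* Where [f] vanishes the value is that of [r], so that the sign of a function
   equivariant on the boundary is equivariant there even at its zeros. *)
Definition sgn_with (f : 'rV[R]_n -> R) (r : X -> bool) (v : X) : bool :=
  if 0 < f (pos v) then true else if f (pos v) < 0 then false else r v.

Lemma hasChar_sgn_with ty flip chi f r :
  hasChar (N := N) ty flip chi r ->
  (forall e v, box (N := N) v -> bd (N := N) ty e v ->
     f (pos (act flip e v)) = (-1) ^+ chi e * f (pos v)) ->
  hasChar (N := N) ty flip chi (sgn_with f r).
Proof.
move=> hr hf e v bv dv; rewrite /sgn_with hf // hr //.
case: (chi e); rewrite /= ?expr1 ?mulN1r ?oppr_gt0 ?oppr_lt0 ?expr0 ?mul1r.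
  by case: (ltgtP (f (pos v)) 0).
by case: ifP => // _; case: ifP.
Qed.

(** A function that changes sign between neighbouring cells is at most [e] in absolute value there,
    and each further step of the chain of faces adds at most [e]. *)
Lemma cups_sgn_small (g : nat -> 'rV[R]_n -> R) (r : nat -> X -> bool) e m c v :
  ~~ odd N -> 0 <= e ->
  (forall i v w, (i < m)%N -> box (N := N) v -> face w v ->
     `|g i (pos v) - g i (pos w)| <= e) ->
  box (N := N) v -> cups (fun i => sgn_with (g i) (r i)) m c v ->
  forall i, (i < m)%N -> `|g i (pos v)| <= m%:R * e.
Proof.
move=> Ne e0; elim: m v => // m IH v hg bv /cup_true[w [wv cw sw]] i im.
have bw := box_face Ne _ _ bv wv.
have hi := hg i v w im bv wv.
have [{}im|mi] := ltnP i m.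
  have := IH w (fun i v w im => hg i v w (ltnW im)) bw cw i im => h.
  rewrite -natr1 mulrDl mul1r -[g i (pos v)](subrK (g i (pos w))) addrC.
  by apply: le_trans (ler_normD _ _) _; rewrite lerD.
have {mi im} mE : i = m by apply/eqP; rewrite eqn_leq mi -ltnS im.
subst i; suff : `|g m (pos v)| <= e.
  by move=> /le_trans; apply; rewrite ler_peMl // ler1n.
apply: le_trans hi; move: sw; rewrite /sgn_with.
move: (g m (pos v)) (g m (pos w)) => a b.
have [a0|a0|->] := ltgtP a 0; last by rewrite normr0.
- have [b0|b0|->] := ltgtP b 0; rewrite ?eqxx // => _; last by rewrite subr0.
  by rewrite ltr0_norm // ltr0_norm; lra.
- have [b0|b0|->] := ltgtP b 0; rewrite ?eqxx // => _; last by rewrite subr0.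
  by rewrite gtr0_norm // gtr0_norm; lra.
Qed.

End SignFunctions.

Lemma pos_cube (R : realType) n N (v : {ffun 'I_n -> int}) :
  (0 < N)%N -> box (N := N) v -> unit_cube R n (pos N v).
Proof.
move=> N0 bv i; rewrite mxE normrM normfV [`|N%:R|]ger0_norm ?ler0n //.
by rewrite ler_pdivrMr ?ltr0n // mul1r -intr_norm -[N%:R]/((N%:Z)%:~R) ler_int.
Qed.

(** The bound on [N] is uniform in [r], because the references used later depend on [N]. *)
Lemma cups_sgn_vanish (R : realType) n (g : nat -> 'rV[R]_n -> R) m :
  (forall i, continuous (g i)) -> (forall x, exists2 i, (i < m)%N & g i x != 0) ->
  \forall N \near \oo, forall (r : nat -> {ffun 'I_n -> int} -> bool) c v,
    ~~ odd N -> box (N := N) v ->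
    cups (fun i => sgn_with N (g i) (r i)) m c v = false.
Proof.
move=> cg g0; have [e e0 he] := common_zero_gap _ _ _ _ cg g0.
near=> N => r c v Ne bv; apply/negP => cv.
have N0 : (0 < N)%N by near: N; exact: nbhs_infty_gt.
have [i im] := he _ (pos_cube R _ _ _ N0 bv); rewrite ltNge; apply/negP/negPn.
apply: (cups_sgn_small _ _ _ _ _ _ _ Ne (ltW e0) _ bv cv i im).
move=> {im bv cv}i {}v w im bv wv.
have uc : forall k : 'I_m, forall x y : 'rV[R]_n, unit_cube R n x ->
    (forall i, `|x ord0 i - y ord0 i| <= N%:R^-1) -> `|g k x - g k y| <= e.
  near: N; apply: filter_forall => k; exact: unif_continuous_unit_cube.
apply: (uc (Ordinal im)); first exact: pos_cube.
move=> k; rewrite !mxE -mulrBl normrM normfV [`|N%:R|]ger0_norm ?ler0n //.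
rewrite ler_piMl ?invr_ge0 ?ler0n // -intrB -intr_norm.
rewrite -[1]/((1%:Z)%:~R) ler_int.
by case: wv => l _ [] ->; rewrite updE; case: eqP => [->|_]; lia.
Unshelve. all: by end_near. Qed.

(** * Signs that distinguish opposite grid points *)

Section Reference.
Context {n : nat}.
Notation X := {ffun 'I_n -> int}.
Implicit Types (P : pred 'I_n) (v : X).

Definition restr P v : X := [ffun i => if P i then v i else 0].

(* An arbitrary choice of a representative in each pair of opposite points. *)
Definition orient P v : bool := (pickle (restr P v) < pickle (- restr P v))%N.

Lemma orientN P v v' : restr P v' = - restr P v -> restr P v != 0 ->
  orient P v' = ~~ orient P v.
Proof.
move=> E v0; rewrite /orient E opprK.
set u := restr P v in v0 *; rewrite -leqNgt ltn_neqAle.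
suff -> : pickle (- u) != pickle u by [].
apply: contra v0 => /eqP /(pcan_inj pickleK) uu; apply/eqP/ffunP => i.
by have := congr1 (fun u : X => u i) uu; rewrite !ffunE; lia.
Qed.

Lemma restrN P v v' : (forall i, P i -> v' i = - v i) -> restr P v' = - restr P v.
Proof.
move=> h; apply/ffunP => i; rewrite !ffunE.
by case: ifP => [/h|]; rewrite ?oppr0.
Qed.

Lemma eq_restr P v v' : (forall i, P i -> v' i = v i) -> restr P v' = restr P v.
Proof. by move=> h; apply/ffunP => i; rewrite !ffunE; case: ifP => [/h|]. Qed.

Lemma restr_neq0 P v i : P i -> v i != 0 -> restr P v != 0.
Proof.
move=> Pi; apply: contra => /eqP /(congr1 (fun u : X => u i)).
by rewrite !ffunE Pi => ->.
Qed.

End Reference.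

(** * Two gluings of the cube *)

Section TwoInvolutions.
Context (d' j : nat).
Notation d := d'.+1.
Notation D := (d' + j + d').+1.
Notation X := {ffun 'I_D -> int}.

(* The coordinates of the cube are those of [q] and [w], in this order, followed
   by those of [p] except the last one. *)
Definition isQ (i : nat) : bool := (i < d)%N.
Definition isW (i : nat) : bool := (d <= i < d + j)%N.
Definition isP (i : nat) : bool := (d + j <= i)%N.

(** The cube of the coordinates of [q] and [p] stands for a hemisphere of [S^(2d-1)], closed up by
    the involution [false], [(p, q) -> (- p, - q)]; that of [w] for a hemisphere of [S^j], closed up
    by [true], [(q, w) -> (- q, - w)]. *)
Definition glue_type (i : 'I_D) : bool := isW i.
Definition glue_flip (e : bool) (i : 'I_D) : bool := if e then ~~ isP i else ~~ isW i.

Lemma glue_flip_type i : glue_flip (glue_type i) i.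
Proof. rewrite /glue_flip /glue_type /isP /isW; case: ifP => //; lia. Qed.

Notation hasChar N := (hasChar (N := N) glue_type glue_flip).

(** The characters of [p] and of [w]; their sum is true on both involutions and is that of [q]. *)
Definition charX (e : bool) : bool := ~~ e.
Definition charY (e : bool) : bool := e.

Section References.
Context {N : nat}.
Hypothesis N_gt1 : (1 < N)%N.

Definition bdry (v : X) : bool := [exists i, `|v i| == N%:Z].

(** The value is false off the boundary, so that signs at zeros near the origin are known when the
    top class is evaluated. *)
Definition refY (v : X) : bool := bdry v && orient (fun i => isW i) v.

(** Where [p] vanishes, the orientations of [q] and [w] together have the character of [p]. Where
    [q] vanishes too, the point is on no facet glued by [false], and a constant will do. *)
Definition refX (v : X) : bool := bdry v &&
  (if restr (fun i => isP i) v != 0 then orient (fun i => isP i) v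
   else if restr (fun i => isQ i) v != 0 then
     orient (fun i => isQ i) v + orient (fun i => isW i) v
   else false).

Lemma bdry_act e v : bdry (act glue_flip e v) = bdry v.
Proof. by apply: eq_existsb => i; rewrite ffunE; case: ifP; rewrite ?normrN. Qed.

Lemma bd_bdry e v : bd (N := N) glue_type e v -> bdry v.
Proof. by move=> /existsP[i /andP[_ vi]]; apply/existsP; exists i. Qed.

Lemma eq_orient (P : pred 'I_D) e (v : X) : (forall i, P i -> ~~ glue_flip e i) ->
  orient P (act glue_flip e v) = orient P v.
Proof.
move=> h; rewrite /orient (eq_restr _ v) // => i Pi.
by rewrite ffunE (negbTE (h i Pi)).
Qed.

Lemma hasChar_refY : hasChar N charY refY.
Proof.
move=> e v bv dv; rewrite /refY bdry_act (bd_bdry _ _ dv) /=.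
move: dv => /existsP[k /andP[/eqP kt /eqP vk]].
case: e kt => kt; rewrite /charY ?addr0; last first.
  by apply: eq_orient => i; rewrite /glue_flip negbK.
have vk0 : v k != 0 by apply/eqP => v0; move: vk N_gt1; rewrite v0; lia.
rewrite (orientN _ v); first by case: (orient _ v).
- by apply: restrN => i iW; rewrite ffunE /glue_flip ifT //; move: iW; rewrite /isW /isP; lia.
- by apply: restr_neq0 vk0.
Qed.

Lemma hasChar_refX : hasChar N charX refX.
Proof.
move=> e v bv dv; rewrite /refX bdry_act (bd_bdry _ _ dv) /=.
move: dv => /existsP[k /andP[/eqP kt /eqP vk]].
have vk0 : v k != 0 by apply/eqP => v0; move: vk N_gt1; rewrite v0; lia.
case: e kt => kt; rewrite /charX /= ?addr0.
  have QN : restr (fun i => isQ i) (act glue_flip true v) =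
            - restr (fun i => isQ i) v.
    by apply: restrN => i iQ; rewrite ffunE /glue_flip ifT //; move: iQ; rewrite /isQ /isP; lia.
  have WN : restr (fun i => isW i) (act glue_flip true v) =
            - restr (fun i => isW i) v.
    by apply: restrN => i iW; rewrite ffunE /glue_flip ifT //; move: iW; rewrite /isW /isP; lia.
  have PE : restr (fun i => isP i) (act glue_flip true v) =
            restr (fun i => isP i) v.
    by apply: eq_restr => i iP; rewrite ffunE /glue_flip iP.
  rewrite PE QN oppr_eq0; case: ifP => p0.
    by rewrite /orient PE.
  case: ifP => // q0.
  have w0 : restr (fun i => isW i) v != 0 by apply: restr_neq0 vk0.
  rewrite (orientN _ _ _ QN q0) (orientN _ _ _ WN w0).
  by case: (orient _ v); case: (orient _ v).
have QN : restr (fun i => isQ i) (act glue_flip false v) =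
          - restr (fun i => isQ i) v.
  by apply: restrN => i iQ; rewrite ffunE /glue_flip ifT //; move: iQ; rewrite /isQ /isW; lia.
have PN : restr (fun i => isP i) (act glue_flip false v) =
          - restr (fun i => isP i) v.
  by apply: restrN => i iP; rewrite ffunE /glue_flip ifT //; move: iP; rewrite /isP /isW; lia.
have WE : orient (fun i => isW i) (act glue_flip false v) =
          orient (fun i => isW i) v.
  by apply: eq_orient => i; rewrite /glue_flip negbK.
rewrite PN QN !oppr_eq0; case: ifPn => p0.
  by rewrite (orientN _ _ _ PN p0); case: (orient _ v).
have q0 : restr (fun i => isQ i) v != 0.
  move: p0; rewrite negbK => /eqP p0; apply: restr_neq0 (vk0).
  have kP : isP k = false.
    apply/negP => kP; move/eqP: vk0; apply.
    by have := congr1 (fun u : X => u k) p0; rewrite !ffunE kP.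
  by move: kt kP; rewrite /glue_type /isQ /isW /isP; lia.
rewrite q0 (orientN _ _ _ QN q0) WE.
by case: (orient _ v); case: (orient _ v).
Qed.

Definition refZ (v : X) : bool := refX v + refY v.

Lemma hasChar_refZ : hasChar N (fun e => charX e + charY e) refZ.
Proof.
by move=> e v bv dv; rewrite /refZ hasChar_refX // hasChar_refY // addrACA.
Qed.

Lemma ref_interior (v : X) : (forall i, `|v i| <= 1) ->
  [/\ refX v = false, refY v = false & refZ v = false].
Proof.
move=> v1; suff b0 : bdry v = false by rewrite /refZ /refX /refY b0.
by apply/negbTE/negP => /existsP[i /eqP vi]; move: (v1 i) N_gt1; lia.
Qed.

End References.

(** * Continuous functions on the cube with given characters *)

Section Functions.
Context {R : realType}.
Implicit Types (x : 'rV[R]_D).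

Definition xflip e x : 'rV[R]_D := \row_i (if glue_flip e i then - x ord0 i else x ord0 i).

Definition xbd e x : Prop := exists2 i, glue_type i = e & `|x ord0 i| = 1.

Definition coord (k : nat) x : R := x ord0 (inord k).

(* The last coordinates of [w] and [p]: functions of the others that vanish on the
   facets where the corresponding sphere is closed up. *)
Definition bumpW x : R := \prod_(i < D | isW i) (1 - x ord0 i ^+ 2).
Definition bumpPQ x : R := \prod_(i < D | ~~ isW i) (1 - x ord0 i ^+ 2).

Lemma bumpW_flip e x : bumpW (xflip e x) = bumpW x.
Proof.
by apply: eq_bigr => i _; rewrite mxE; case: ifP; rewrite ?sqrrN.
Qed.

Lemma bumpPQ_flip e x : bumpPQ (xflip e x) = bumpPQ x.
Proof.
by apply: eq_bigr => i _; rewrite mxE; case: ifP; rewrite ?sqrrN.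
Qed.

Lemma bumpW_bd x : xbd true x -> bumpW x = 0.
Proof.
move=> [i iW xi]; rewrite /bumpW (bigD1 i) //=.
by rewrite -real_normK ?num_real // xi expr1n subrr mul0r.
Qed.

Lemma bumpPQ_bd x : xbd false x -> bumpPQ x = 0.
Proof.
move=> [i iW xi]; rewrite /bumpPQ (bigD1 i) /=; last by rewrite -/(glue_type i) iW.
by rewrite -real_normK ?num_real // xi expr1n subrr mul0r.
Qed.

Lemma coord_flip e k x : (k < D)%N ->
  coord k (xflip e x) = if (if e then ~~ isP k else ~~ isW k) then - coord k x else coord k x.
Proof. by move=> kD; rewrite /coord mxE /glue_flip inordK. Qed.

Lemma continuous_coord k : continuous (coord k).
Proof. exact: coord_continuous. Qed.

Lemma continuous_bump (P : pred 'I_D) :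
  continuous (fun x => \prod_(i < D | P i) (1 - x ord0 i ^+ 2)).
Proof.
apply: continuous_prodR => i _ x.
have h := @coord_continuous R 1 D ord0 i x.
exact: (cvgB (cvg_cst (1 : R)) (cvgM h h)).
Qed.

Lemma xflip_pos N e v : xflip e (pos N v) = pos N (act glue_flip e v).
Proof.
apply/rowP => i; rewrite !mxE ffunE.
by case: ifP; rewrite ?mulrNz ?mulNr.
Qed.

Lemma xbd_pos N e v : (0 < N)%N -> bd (N := N) glue_type e v -> xbd e (pos N v).
Proof.
move=> N0 /existsP[i /andP[/eqP ti /eqP vi]]; exists i => //.
rewrite mxE normrM normfV [`|N%:R|]ger0_norm ?ler0n // -intr_norm vi.
by rewrite divff // pnatr_eq0 -lt0n.
Qed.

Lemma hasChar_sgn N chi f r : (0 < N)%N -> hasChar N chi r ->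
  (forall e x, xbd e x -> f (xflip e x) = (-1) ^+ chi e * f x) ->
  hasChar N chi (sgn_with N f r).
Proof.
move=> N0 hr hf; apply: hasChar_sgn_with => // e v bv dv.
by rewrite -xflip_pos hf //; exact: xbd_pos.
Qed.

(** The [j.+1] coordinates of [w], the [d] coordinates of [p] and the [d + d] coordinates of
    [(q, p)], each sphere being described without normalisation. *)
Definition famY (i : nat) : 'rV[R]_D -> R :=
  if (i < j)%N then coord (d + i) else bumpW.
Definition famX (i : nat) : 'rV[R]_D -> R :=
  if (i < d')%N then coord (d + j + i) else bumpPQ.
Definition famZX (i : nat) : 'rV[R]_D -> R :=
  if (i < d)%N then coord i else famX (i - d).

Lemma continuous_famX i : continuous (famX i).
Proof.
rewrite /famX; case: ifP => _; [exact: continuous_coord|exact: continuous_bump].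
Qed.

Lemma continuous_famY i : continuous (famY i).
Proof.
rewrite /famY; case: ifP => _; [exact: continuous_coord|exact: continuous_bump].
Qed.

Lemma continuous_famZX i : continuous (famZX i).
Proof.
rewrite /famZX; case: ifP => _; [exact: continuous_coord|exact: continuous_famX].
Qed.

Lemma bumpW_neq0 x : (forall i, (i < j)%N -> coord (d + i) x = 0) -> bumpW x != 0.
Proof.
move=> x0; rewrite /bumpW big1 ?oner_eq0 // => i /andP[di ij].
have := x0 (i - d)%N; rewrite subnKC // /coord inord_val => ->; last by lia.
by rewrite expr0n subr0.
Qed.

Lemma bumpPQ_neq0 x : (forall i, (i < d)%N -> coord i x = 0) ->
  (forall i, (i < d')%N -> coord (d + j + i) x = 0) -> bumpPQ x != 0.
Proof.
move=> q0 p0; rewrite /bumpPQ big1 ?oner_eq0 // => i iW.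
suff -> : x ord0 i = 0 by rewrite expr0n subr0.
have [iQ|iQ] := ltnP i d; first by rewrite -(q0 i iQ) /coord inord_val.
have iP : (d + j <= i)%N by move: iW; rewrite /isW; lia.
have := p0 (i - (d + j))%N; rewrite subnKC // /coord inord_val => -> //.
by have := ltn_ord i; lia.
Qed.

Lemma famY_neq0 x : exists2 i, (i < j.+1)%N & famY i x != 0.
Proof.
apply: contrapT => h.
have h' i : (i < j.+1)%N -> famY i x = 0.
  by move=> ij; apply/eqP/negPn/negP => fi; apply: h; exists i.
have := h' j (ltnSn j); rewrite /famY ltnn; apply/eqP/bumpW_neq0 => i ij.
by have := h' i (ltnW ij); rewrite /famY ij.
Qed.

Lemma famZX_neq0 x : exists2 i, (i < d + d)%N & famZX i x != 0.
Proof.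
apply: contrapT => h.
have h' i : (i < d + d)%N -> famZX i x = 0.
  by move=> ij; apply/eqP/negPn/negP => fi; apply: h; exists i.
have hX i : (i < d)%N -> famX i x = 0.
  move=> id; have := h' (d + i)%N; rewrite /famZX ifF ?addKn; last by lia.
  by apply; lia.
have := hX d' (ltnSn d'); rewrite /famX ltnn; apply/eqP/bumpPQ_neq0 => i id.
  by have := h' i; rewrite /famZX id; apply; lia.
by have := hX i (ltnW id); rewrite /famX id.
Qed.

Lemma coordZ_flip e i x : (i < d)%N ->
  coord i (xflip e x) = (-1) ^+ (charX e (+) charY e) * coord i x.
Proof.
move=> id; rewrite coord_flip; last by lia.
rewrite ifT; last by case: e; rewrite /isP /isW; lia.
by case: e; rewrite /charX /charY /= expr1 mulN1r.
Qed.

(** The last function is even under every flip; it is also odd where required because it vanishes on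
    the facets glued by [true]. *)
Lemma famY_flip e i x : xbd e x -> famY i (xflip e x) = (-1) ^+ charY e * famY i x.
Proof.
rewrite /famY; case: ifP => ij bx; last first.
  rewrite bumpW_flip; case: e bx => bx; last by rewrite expr0 mul1r.
  by rewrite bumpW_bd // mulr0.
rewrite coord_flip; last by lia.
case: e {bx}; rewrite /charY /= ?expr1 ?expr0 ?mulN1r ?mul1r.
  by rewrite ifT // /isP; lia.
by rewrite ifF // /isW; lia.
Qed.

Lemma famX_flip e i x : xbd e x -> famX i (xflip e x) = (-1) ^+ charX e * famX i x.
Proof.
rewrite /famX; case: ifP => ij bx; last first.
  rewrite bumpPQ_flip; case: e bx => bx; first by rewrite expr0 mul1r.
  by rewrite bumpPQ_bd // mulr0.
rewrite coord_flip; last by lia.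
case: e {bx}; rewrite /charX /= ?expr1 ?expr0 ?mulN1r ?mul1r.
  by rewrite ifF // /isP; lia.
by rewrite ifT // /isW; lia.
Qed.

Lemma hasChar_coordZ N i : (1 < N)%N -> (i < d)%N ->
  hasChar N (fun e => charX e + charY e) (sgn_with N (coord i) (refZ (N := N))).
Proof.
move=> N1 id; apply: hasChar_sgn (ltnW N1) (hasChar_refZ N1) _ => e x _.
exact: coordZ_flip.
Qed.

Lemma hasChar_famY N i : (1 < N)%N ->
  hasChar N charY (sgn_with N (famY i) (refY (N := N))).
Proof.
move=> N1; apply: hasChar_sgn (ltnW N1) (hasChar_refY N1) _ => e x.
exact: famY_flip.
Qed.

Lemma hasChar_famX N i : (1 < N)%N ->
  hasChar N charX (sgn_with N (famX i) (refX (N := N))).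
Proof.
move=> N1; apply: hasChar_sgn (ltnW N1) (hasChar_refX N1) _ => e x.
exact: famX_flip.
Qed.

(* A Borsuk-Ulam theorem: two boundary gluings of the cube yield
   [(S^(2d-1) x S^j) / (Z/2)^2], and the [D]-th power of the character sum is
   nonzero there when [j] is the 2-part of [d]. *)
Lemma glued_map_has_zero (m k n : nat) (h : 'rV[R]_D -> 'rV[R]_n) :
  j = (2 ^ k)%N -> odd m -> d = (m * j)%N -> (n <= D)%N -> continuous h ->
  (forall e x, xbd e x -> h (xflip e x) = - h x) -> exists x, h x = 0.
Proof.
move=> jk om dm nD ch hh; apply: contrapT => h0.
case: n nD h ch hh h0 => [|n] nD h ch hh h0.
  by apply: h0; exists 0; apply/rowP => -[].
pose g (i : nat) x := h x ord0 (inord i).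
have cg i : continuous (g i).
  by move=> x; exact: (continuous_comp (ch x) (@coord_continuous R 1 n.+1 ord0 (inord i) (h x))).
have g0 x : exists2 i, (i < n.+1)%N & g i x != 0.
  apply: contrapT => gx; apply: h0; exists x; apply/rowP => i; rewrite mxE.
  apply/eqP/negPn/negP => hx; apply: gx; exists i => //.
  by rewrite /g inord_val.
have [N [N1 Ne vY vZX vg]] : exists N, [/\ (1 < N)%N, ~~ odd N,
   forall (r : nat -> X -> bool) c v, box (N := N) v ->
     cups (fun i => sgn_with N (famY i) (r i)) j.+1 c v = false,
   forall (r : nat -> X -> bool) c v, box (N := N) v ->
     cups (fun i => sgn_with N (famZX i) (r i)) (d + d) c v = false &
   forall (r : nat -> X -> bool) c v, box (N := N) v ->
     cups (fun i => sgn_with N (g i) (r i)) n.+1 c v = false].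
  have vY := cups_sgn_vanish _ _ _ _ continuous_famY famY_neq0.
  have vZX := cups_sgn_vanish _ _ _ _ continuous_famZX famZX_neq0.
  have vg := cups_sgn_vanish _ _ _ _ cg g0.
  have [N0 _ hN] := filterI vY (filterI vZX vg).
  exists (N0.+1).*2; have [|{}vY [{}vZX {}vg]] := hN (N0.+1).*2.
    by rewrite -addnn; apply: leq_trans (leqnSn N0) (leq_addr _ _).
  have Ne : ~~ odd (N0.+1).*2 by rewrite odd_double.
  split=> //.
  - by move=> r c v; exact: vY.
  - by move=> r c v; exact: vZX.
  - by move=> r c v; exact: vg.
have N0 : (0 < N)%N := ltnW N1.
have hX := hasChar_refX N1; have hY := hasChar_refY N1; have hZ := hasChar_refZ N1.
pose e a b c := integral (N := N) (monom (refX (N := N)) (refY (N := N)) a b c).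
have eS a b c : e a.+1 b c = e a b c.+1 + e a b.+1 c.
  exact: (integral_monomS Ne _ _ glue_flip_type N0 _ _ _ _ hX hY).
have ey a b c : (j < b)%N -> e a b c = 0.
  move=> jb; apply: (integral_monom_y Ne _ _ glue_flip_type N0 _ _ _ _ hX hY
     (fun i => sgn_with N (famY i) (refY (N := N)))) jb.
  - by move=> i _; exact: hasChar_famY.
  - exact: (vY (fun=> refY (N := N))).
have exz a b c : (d <= a)%N -> (d <= c)%N -> e a b c = 0.
  apply: (integral_monom_xz Ne _ _ glue_flip_type N0 _ _ _ _ hX hY
     (fun i => sgn_with N (famX i) (refX (N := N)))
     (fun i => sgn_with N (coord i) (refZ (N := N)))).
  - by move=> i _; exact: hasChar_famX.
  - by move=> i id; exact: hasChar_coordZ.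
  - move=> c' v bv.
    (* The coordinates of [q] followed by those of [p] form the single family [famZX], without
       common zero. *)
    apply: etrans (vZX (fun i => if (i < d)%N then refZ (N := N)
      else refX (N := N)) c' v bv); rewrite cupsD.
    congr (cups _ _ _ _).
      by apply/funext => i; rewrite /famZX ifF ?ifF ?addKn //; lia.
    by apply: eq_cups => i id; rewrite /famZX id.
have ez : e 0%N 0%N D = 0.
  apply: (integral_monom_z Ne _ _ glue_flip_type N0 _ _ _ _ hX hY
     (fun i => sgn_with N (g i) (refZ (N := N)))) nD.
  - move=> i _; apply: hasChar_sgn => // e' x bx; rewrite /g hh // mxE.
    by case: e' {bx}; rewrite /charX /charY /= expr1 mulN1r.
  - exact: (vg (fun=> refZ (N := N))).
(* The coordinates of the cube, in the order [q], [w], [p], represent the factors; their product is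
   concentrated on one top cell. *)
have etop : e d' j d = 1.
  rewrite /e -(integral_monom_cups Ne _ _ glue_flip_type N0 _ _ _ _ hX hY
    (fun i => sgn_with N (coord i) (if (i < d)%N then refZ (N := N) else
       if (i < d + j)%N then refY (N := N) else refX (N := N)))).
  - rewrite (_ : (d + j + d' = D)%N) //.
    apply: (integral_cups_coords Ne N0) => [i v bv vi|i v bv vi|i v vlt vge].
    + by rewrite /sgn_with /coord inord_val mxE divr_gt0 ?ltr0z ?ltr0n.
    + rewrite /sgn_with /coord inord_val mxE ltr_pdivlMr ?ltr0n // mul0r ltr0z.
      by rewrite ltr_pdivrMr ?ltr0n // mul0r ltrz0 vi ltNge (ltW vi).
    + rewrite /sgn_with /coord inord_val mxE vge // mul0r ltxx.
      have [|rx ry rz] := ref_interior N1 v; last first.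
        by case: ifP => _; [rewrite rz|case: ifP => _; rewrite ?rx ?ry].
      move=> l; have [li|li] := ltnP l i; first by rewrite vlt.
      by rewrite vge.
  - by move=> i id; rewrite id; exact: hasChar_coordZ.
  - move=> i ij; rewrite ifF ?ifT; try lia.
    by have := hasChar_famY N i N1; rewrite /famY ij.
  - move=> i ij; rewrite ifF ?ifF; try lia.
    by have := hasChar_famX N i N1; rewrite /famX ij.
have := monomial_count e m k om eS.
rewrite -jk -dm => /(_ ey exz); rewrite /= (_ : (d + j + d' = D)%N) // ez etop.
by [].
Qed.

End Functions.
End TwoInvolutions.

(** * Chords of an embedding *)

Section Chords.
Context {R : realType} {d n : nat} (f : 'rV[R]_d -> 'rV[R]_n).
Hypotheses (f_inj : injective f) (f_cont : continuous f).
Hypotheses (no_trapezoid : ~ inscribes_trapezoid f)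
  (no_line : ~ maps_three_points_to_line f).

Lemma collinear_parallel (x y z : 'rV[R]_n) (a b : R) : x != y -> 0 < b ->
  a *: (y - x) = b *: (z - x) -> collinear x y z.
Proof.
move=> xy b0 E; exists [set x + t *: (y - x) | t in [set: R]]; split.
  by exists x, (y - x); split=> //; rewrite subr_eq0 eq_sym.
split.
- by exists 0 => //; rewrite scale0r addr0.
- by exists 1 => //; rewrite scale1r addrC subrK.
- exists (b^-1 * a) => //; rewrite -scalerA E scalerA mulVf ?gt_eqF //.
  by rewrite scale1r addrC subrK.
Qed.

Lemma not_collinear_image x y z :
  x != y -> x != z -> y != z -> ~ collinear (f x) (f y) (f z).
Proof.
move=> xy xz yz h; apply: no_line; exists x, y, z; split=> //.
by rewrite /= !inE negb_or xy xz yz.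
Qed.

(** Otherwise the chords share one end, giving three image points on a line, or are opposite, which
    positive factors forbid, or have four distinct ends, the vertices of a trapezoid. *)
Lemma parallel_chords_eq (a b : R) x y z w : 0 < a -> 0 < b -> x != y -> z != w ->
  a *: (f x - f y) = b *: (f z - f w) -> x = z /\ y = w.
Proof.
move=> a0 b0 xy zw E.
have fxy : f x != f y by rewrite (inj_eq f_inj).
have pos_neg : a *: (f x - f y) != b *: (f y - f x).
  rewrite -subr_eq0 -[f y - f x]opprB scalerN opprK -scalerDl scaler_eq0 subr_eq0.
  by rewrite (negbTE fxy) orbF gt_eqF // addr_gt0.
have [xz|xz] := eqVneq x z.
  split=> //; apply: contrapT => /eqP yw; subst z.
  apply: (not_collinear_image x y w xy zw yw).
  apply: (collinear_parallel _ _ _ a b) => //.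
  by rewrite -[f y - _]opprB -[f w - _]opprB !scalerN E.
exfalso; have [xw|xw] := eqVneq x w.
  subst w; have [yz|yz] := eqVneq y z.
    by subst z; move/eqP: pos_neg; apply.
  apply: (not_collinear_image x y z xy xz yz).
  apply: (collinear_parallel _ _ _ (- a) b) => //.
  by rewrite scaleNr -scalerN opprB.
have [yz|yz] := eqVneq y z.
  subst z; apply: (not_collinear_image y x w _ zw xw); first by rewrite eq_sym.
  apply: (collinear_parallel _ _ _ (- a) b) => //.
    by rewrite (inj_eq f_inj) eq_sym.
  by rewrite scaleNr E -scalerN opprB.
have [yw|yw] := eqVneq y w.
  subst w; apply: (not_collinear_image y x z _ yz xz); first by rewrite eq_sym.
  apply: (collinear_parallel _ _ _ a b) => //.
  by rewrite (inj_eq f_inj) eq_sym.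
apply: no_trapezoid; exists (f x), (f y), (f z), (f w); split.
  by split; [exists x|exists y|exists z|exists w].
split.
- by rewrite /= !inE !negb_or !(inj_eq f_inj) xy xz xw yz yw zw.
- by split; apply: not_collinear_image.
- by exists a, b.
Qed.

(** The exponential lets the positive scale be a parameter [t] on the whole line, which can be
    negated with [c]. *)
Definition chord u c (t : R) : 'rV[R]_n := expR t *: (f (c + u) - f (c - u)).

Lemma chordN u c t : chord (- u) c t = - chord u c t.
Proof. by rewrite /chord opprK -opprB scalerN. Qed.

Lemma chord_eq0 u c t : chord u c t = 0 -> u = 0.
Proof.
move/eqP; rewrite scaler_eq0 gt_eqF ?expR_gt0 //= subr_eq0 (inj_eq f_inj).
rewrite -subr_eq0 opprB addrC addrA subrK -mulr2n -scaler_nat scaler_eq0.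
by rewrite pnatr_eq0 /= => /eqP.
Qed.

(** For [u] nonzero the ends [c + u] and [c - u] are determined; their sum gives [c], then [u]
    follows, and the scale gives [t]. *)
Lemma chord_inj u c t u' c' t' : chord u c t = chord u' c' t' ->
  u = u' /\ (u = 0 \/ c = c' /\ t = t').
Proof.
have chord0 v s : chord 0 v s = 0 by rewrite /chord addr0 subr0 subrr scaler0.
move=> E; have [u0|u0] := eqVneq u 0.
  by move: E; rewrite u0 chord0 => /esym/chord_eq0 ->; split=> //; left.
have [u0'|u0'] := eqVneq u' 0.
  by move: E u0; rewrite u0' chord0 => /chord_eq0 ->; rewrite eqxx.
have dist (v w : 'rV[R]_d) : v != 0 -> w + v != w - v.
  apply: contra; rewrite -subr_eq0 opprB addrC addrA subrK -mulr2n -scaler_nat.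
  by rewrite scaler_eq0 pnatr_eq0.
have [E1 E2] := parallel_chords_eq _ _ _ _ _ _ (expR_gt0 t) (expR_gt0 t')
  (dist _ c u0) (dist _ c' u0') E.
have cc : c = c'.
  have : 2%:R *: c = 2%:R *: c'.
    have := congr2 +%R E1 E2; rewrite !(addrACA _ u) !(addrACA _ u') !subrr !addr0.
    by rewrite -!mulr2n !scaler_nat.
  by apply: scalerI; rewrite pnatr_eq0.
move: E1; rewrite cc => /addrI uu; split=> //; right; split=> //.
move: E; rewrite /chord uu cc => /eqP; rewrite -subr_eq0 -scalerBl scaler_eq0.
rewrite !subr_eq0 (inj_eq f_inj) (negbTE (dist _ c' u0')) orbF => /eqP.
exact: expR_inj.
Qed.

Lemma continuous_chord (T : topologicalType) (u c : T -> 'rV[R]_d) (t : T -> R) :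
  continuous u -> continuous c -> continuous t ->
  continuous (fun x => chord (u x) (c x) (t x)).
Proof.
move=> cu cc ct x.
have h1 := continuous_comp (cvgD (cc x) (cu x)) (f_cont (c x + u x)).
have h2 := continuous_comp (cvgB (cc x) (cu x)) (f_cont (c x - u x)).
have h3 := continuous_comp (ct x) (@continuous_expR R (t x)).
exact: (cvgZ h3 (cvgB (h1 _) (h2 _))).
Qed.

End Chords.

(** * The Hurwitz--Radon bound and the odd map built from chords *)

Lemma hurwitz_radon_le d : (hurwitz_radon d <= 2 ^ logn 2 d)%N.
Proof.
rewrite /hurwitz_radon {3}(divn_eq (logn 2 d) 4).
move: (_ %% 4)%N (_ %/ 4)%N => b a; rewrite expnD mulnC [(a * 4)%N]mulnC expnM.
(* Multiplied by [2 ^ b], this dominates [2 ^ b + 8 * a]. *)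
have h : (1 + 8 * a <= (2 ^ 4) ^ a)%N.
  by elim: a => // a IH; rewrite [((2 ^ 4) ^ a.+1)%N]expnS; move: IH; lia.
have b0 : (0 < 2 ^ b)%N by rewrite expn_gt0.
apply: leq_trans (leq_mul h (leqnn (2 ^ b))); nia.
Qed.

Theorem theorem1 (R : realType) (d n : nat) (hd : (1 <= d)%N)
    (hn : (n <= 2 * d + hurwitz_radon d - 1)%N)
    (f : 'rV[R]_d -> 'rV[R]_n) (hf : topological_embedding f) :
  inscribes_trapezoid f \/ maps_three_points_to_line f.
Proof.
case: hf => f_inj f_cont _; apply: contrapT => /not_orP[noT noL].
have := hurwitz_radon_le d; set k := logn 2 d => hr.
case: d => [//|d'] in hd f f_inj f_cont noT noL k hn hr *.
pose j := (2 ^ k)%N; pose m := (d'.+1 %/ j)%N.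
have dm : d'.+1 = (m * j)%N by rewrite /m divnK // /j /k pfactor_dvdnn.
have j0 : (0 < j)%N by rewrite expn_gt0.
have om : odd m.
  apply/negPn/negP; rewrite -dvdn2 => m2.
  have : (2 ^ k.+1 %| d'.+1)%N by rewrite expnS dm dvdn_mul.
  by rewrite pfactor_dvdn // ltnn.
have jd : (j <= d'.+1)%N by rewrite dm leq_pmull //; case: (m) om.
have nD : (n <= (d' + j + d').+1)%N by move: hn hr; rewrite -/j; lia.
pose p x : 'rV[R]_d'.+1 := \row_i famX d' j i x.
pose q x : 'rV[R]_d'.+1 := \row_i coord d' j i x.
(* The first [j] coordinates of [w], padded with zeros since [j] is at most [d]; the last one,
   [famY d' j j], serves as the parameter [t]. *)
pose c x : 'rV[R]_d'.+1 := \row_(i < d'.+1) if (i < j)%N then famY d' j i x else 0.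
pose h x := chord f (p x + q x) (c x) (famY d' j j x) -
  chord f (p x - q x) (- c x) (- famY d' j j x).
have cp : continuous p.
  apply: continuous_row => i; rewrite (_ : (fun x => _) = famX d' j i).
    exact: continuous_famX.
  by apply/funext => x; rewrite mxE.
have cq : continuous q.
  apply: continuous_row => i; rewrite (_ : (fun x => _) = coord d' j i).
    exact: continuous_coord.
  by apply/funext => x; rewrite mxE.
have cc : continuous c.
  apply: continuous_row => i; rewrite (_ : (fun x => _) =
      if (i < j)%N then famY d' j i else fun=> 0).
    by case: ifP => _; [exact: continuous_famY|exact: cst_continuous].
  by apply/funext => x; rewrite mxE; case: ifP.
have ct : continuous (famY (R := R) d' j j) by exact: continuous_famY.
have ch : continuous h.
  have cD : continuous (fun x => p x + q x) by move=> x; exact: (cvgD (cp x) (cq x)).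
  have cB : continuous (fun x => p x - q x) by move=> x; exact: (cvgB (cp x) (cq x)).
  have cNc : continuous (fun x => - c x) by move=> x; exact: (cvgN (cc x)).
  have cNt : continuous (fun x => - famY (R := R) d' j j x).
    by move=> x; exact: (cvgN (ct x)).
  move=> x; exact: (cvgB (continuous_chord f f_cont _ _ _ _ cD cc ct x)
    (continuous_chord f f_cont _ _ _ _ cB cNc cNt x)).
have hflip e x : xbd d' j e x -> h (xflip d' j e x) = - h x.
  move=> bx.
  have pE : p (xflip d' j e x) = (-1) ^+ charX e *: p x.
    by apply/rowP => i; rewrite !mxE famX_flip.
  have qE : q (xflip d' j e x) = - q x.
    apply/rowP => i; rewrite !mxE coordZ_flip //.
    by case: (e); rewrite /charX /charY /= expr1 mulN1r.
  have cE : c (xflip d' j e x) = (-1) ^+ charY e *: c x.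
    by apply/rowP => i; rewrite !mxE; case: ifP => _; rewrite ?famY_flip ?mulr0.
  (* The involution [true] exchanges the two chords; [false] reverses each of them. *)
  rewrite /h pE qE cE famY_flip //; case: (e); rewrite /charX /charY /=.
    by rewrite !expr1 !expr0 !scale1r !scaleN1r !mulN1r !opprK opprB.
  rewrite !expr1 !expr0 !scale1r !scaleN1r !mul1r.
  rewrite opprK -opprD (_ : - p x + q x = - (p x - q x)); last by rewrite opprB addrC.
  by rewrite !chordN opprB opprK addrC.
have [x hx] := glued_map_has_zero d' j m k n h erefl om dm nD ch hflip.
have twice0 (V : lmodType R) (v : V) : v = - v -> v = 0.
  move/eqP; rewrite -addr_eq0 -mulr2n -scaler_nat scaler_eq0 pnatr_eq0 /=.
  by move/eqP.
(* At a zero the two chords agree, so [p + q = p - q] and [q = 0]. Then either [p = 0], against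
   [famZX_neq0], or [w = - w], against [famY_neq0]. *)
move/eqP: hx; rewrite subr_eq0 => /eqP /(chord_inj _ f_inj noT noL)[pq pc].
have q0 : q x = 0 by have /addrI := pq; exact: twice0.
case: pc => [|[c0 t0]].
  rewrite q0 addr0 => p0; have [i id] := famZX_neq0 d' j x.
  rewrite /famZX; case: ifP => id'; apply/negP/negPn/eqP.
    by have := congr1 (fun u : 'rV_d'.+1 => u ord0 (Ordinal id')) q0; rewrite !mxE.
  have id2 : (i - d'.+1 < d'.+1)%N by lia.
  by have := congr1 (fun u : 'rV_d'.+1 => u ord0 (Ordinal id2)) p0; rewrite !mxE.
have [i ij] := famY_neq0 d' j x; apply/negP/negPn/eqP.
move: ij; rewrite ltnS leq_eqVlt => /orP[/eqP -> | ij].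
  exact: (twice0 R^o).
have id : (i < d'.+1)%N by exact: leq_trans ij jd.
have := congr1 (fun u : 'rV_d'.+1 => u ord0 (Ordinal id)) (twice0 _ _ c0).
by rewrite !mxE /= ij.
Qed.
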